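(* Let $g$ be a left-invariant Riemannian metric on $\mathrm{GL}(n)$ that is also right-invariant under $\mathrm{O}(n)$; that is, for some constants $\mu,\mu_c,\kappa>0$, $$g_H(X,Y)=\langle H^{-1}X,\,H^{-1}Y\rangle_{\mu,\mu_c,\kappa}\qquad\text{for all } H\in \mathrm{GL}(n),\ X,Y\in T_H\mathrm{GL}(n)=\mathbb{R}^{n\times n},$$ where $$\langle X,Y\rangle_{\mu,\mu_c,\kappa}=\mu\,\langle \operatorname{dev}\operatorname{sym}X,\operatorname{dev}\operatorname{sym}Y\rangle_{n\times n}+\mu_c\,\langle\operatorname{skew}X,\operatorname{skew}Y\rangle_{n\times n}+\tfrac{\kappa}{2}\,\operatorname{tr}X\,\operatorname{tr}Y .$$ Let $F\in\mathrm{GL}^+(n)$, with polar decomposition $F=RU$, where $R=\operatorname{polar}(F)\in\mathrm{SO}(n)$ and $U=\sqrt{F^TF}$ is symmetric positive definite. Then $$\operatorname{dist}_{\rm geod}^2(F,\mathrm{SO}(n))=\operatorname{dist}_{\rm geod}^2(F,\operatorname{polar}(F))=\mu\,\|\operatorname{dev}\log U\|^2+\frac{\kappa}{2}\,[\operatorname{tr}(\log U)]^2 .$$ In particular, the result is independent of the parameter $\mu_c>0$.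
   Context: $\mathrm{GL}(n)$ is the group of invertible real $n\times n$ matrices, $\mathrm{GL}^+(n)$ its subgroup of matrices with positive determinant, $\mathrm{O}(n)$ the orthogonal group and $\mathrm{SO}(n)$ the group of rotations (orthogonal matrices of determinant $1$). Left-invariance of $g$ means $g_H(X,Y)=\langle H^{-1}X,H^{-1}Y\rangle$ for an inner product $\langle\cdot,\cdot\rangle$ on the tangent space $T_{I}\mathrm{GL}(n)=\mathbb{R}^{n\times n}$ at the identity matrix $I$. Such a metric is right-invariant under $\mathrm{O}(n)$ if and only if this inner product has the form $\langle\cdot,\cdot\rangle_{\mu,\mu_c,\kappa}$ for some $\mu,\mu_c,\kappa>0$; the constants $\mu,\mu_c,\kappa$ are those associated with $g$ in this way ($\mu_c$ is called the spin modulus). Notation: $\operatorname{sym}X=\tfrac12(X+X^T)$, $\operatorname{skew}X=\tfrac12(X-X^T)$, $\operatorname{dev}X=X-\tfrac1n(\operatorname{tr}X)\,I$, $\langle X,Y\rangle_{n\times n}=\operatorname{tr}(X^TY)$, and $\|X\|=\sqrt{\operatorname{tr}(X^TX)}$ (Frobenius norm). $\log$ is the principal matrix logarithm; for symmetric positive definite $U$, $\log U$ is the unique symmetric matrix with $\exp(\log U)=U$. Geodesic distance: for $F,P\in\mathrm{GL}^+(n)$, $$\operatorname{dist}_{\rm geod}(F,P)=\inf_{\gamma\in\mathcal{A}}L(\gamma),\qquad L(\gamma)=\int_0^1\sqrt{g_{\gamma(s)}(\dot\gamma(s),\dot\gamma(s))}\,ds,$$ where $\mathcal{A}$ is the set of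 continuous, piecewise differentiable (sufficiently smooth) curves $\gamma:[0,1]\to\mathrm{GL}^+(n)$ with $\gamma(0)=F$ and $\gamma(1)=P$. The distance to $\mathrm{SO}(n)$ is defined by $$\operatorname{dist}_{\rm geod}^2(F,\mathrm{SO}(n))=\min_{Q\in\mathrm{SO}(n)}\operatorname{dist}_{\rm geod}^2(F,Q).$$ *)

(* Defs.v *)
From HB Require Import structures.
From mathcomp Require Import all_boot all_order all_algebra.
From mathcomp Require Import all_classical all_reals all_analysis.

Set Implicit Arguments.
Unset Strict Implicit.
Unset Printing Implicit Defensive.

Import Order.TTheory GRing.Theory Num.Theory.
Import numFieldNormedType.Exports.

Local Open Scope classical_set_scope.
Local Open Scope ring_scope.

Section MatrixAlgebra.
Context {R : realType} {n : nat}.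
Implicit Types A F L Q U X Y : 'M[R]_n.

Definition symm X : 'M[R]_n := 2^-1 *: (X + X^T).
Definition skew X : 'M[R]_n := 2^-1 *: (X - X^T).
Definition dev X : 'M[R]_n := X - (n%:R^-1 * \tr X)%:M.

Definition frob X Y : R := \tr (X^T *m Y).

(* The norm `|X| of the library is the maximum norm, hence a separate name. *)
Definition frob_norm X : R := Num.sqrt (frob X X).

Definition inner mu mu_c kappa X Y : R :=
  mu * frob (dev (symm X)) (dev (symm Y)) +
  mu_c * frob (skew X) (skew Y) +
  kappa / 2 * (\tr X * \tr Y).

Definition GLp : set 'M[R]_n := [set F | 0 < \det F].
Definition SO : set 'M[R]_n := [set Q | Q^T *m Q = 1%:M /\ \det Q = 1].

Definition spd U : Prop :=
  U^T = U /\ forall v : 'cV[R]_n, v != 0 -> 0 < (v^T *m U *m v) 0 0.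

Definition mexp A : 'M[R]_n := limn (series (fun k => k`!%:R^-1 *: A ^+ k)).

(* The next two definitions are only meant for symmetric positive definite
   arguments, on which the matrix described exists and is unique; on other
   arguments without such a matrix the value is 0. *)
Definition msqrt A : 'M[R]_n := xget 0 [set U | spd U /\ U *m U = A].
Definition mlog U : 'M[R]_n := xget 0 [set L | L^T = L /\ mexp L = U].

(* Rotational factor R of F = R U with U = sqrt(F^T F). *)
Definition polar F : 'M[R]_n := F *m invmx (msqrt (F^T *m F)).

End MatrixAlgebra.

Arguments GLp R n : clear implicits.
Arguments SO R n : clear implicits.

Section GeodesicDistance.
Context {R : realType} {n : nat}.
Implicit Types (g : 'M[R]_n -> 'M[R]_n -> 'M[R]_n -> R) (c : R -> 'M[R]_n).
Implicit Types F P H X Y : 'M[R]_n.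

(* A metric is a family g H X Y of bilinear forms in X, Y; its values at
   singular H carry no meaning. *)
Definition metric_with_moduli g mu mu_c kappa : Prop :=
  forall H X Y, H \in unitmx ->
    g H X Y = inner mu mu_c kappa (invmx H *m X) (invmx H *m Y).

(* C^1 on the closed interval: the derivative in the interior extends
   continuously to the endpoints, with the extension given by v. *)
Definition C1_on (a b : R) c : Prop :=
  {within `[a, b], continuous c} /\
  exists v : R -> 'M[R]_n,
    {within `[a, b], continuous v} /\
    forall t, a < t < b -> is_derive t (1 : R) c (v t).

(* The breakpoints of the subdivision are 0 followed by the items of s. *)
Definition piecewise_C1 c : Prop :=
  exists s : seq R,
    [/\ path <%R 0 s, last 0 s = 1 &
        forall i, (i < size s)%N ->
          C1_on (nth 0 (0 :: s) i) (nth 0 (0 :: s) i.+1) c].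

(* Curves are total functions on R of which only the restriction to [0, 1] is
   constrained; this is harmless in curve_length because {0, 1} and the interior
   breakpoints, where derive1 c may be meaningless, are Lebesgue-negligible. *)
Definition admissible F P : set (R -> 'M[R]_n) :=
  [set c | [/\ {within `[(0 : R), 1], continuous c}, piecewise_C1 c,
               forall t, 0 <= t <= 1 -> GLp R n (c t),
               c 0 = F & c 1 = P]].

Definition speed g c (s : R) : R :=
  Num.sqrt (g (c s) (derive1 c s) (derive1 c s)).

Definition curve_length g c : \bar R :=
  (\int[@lebesgue_measure R]_(s in `[0%R, 1%R]) (speed g c s)%:E)%E.

Definition geod_dist g F P : \bar R :=
  ereal_inf [set curve_length g c | c in admissible F P].

(* The least element of S; +oo if S has none. *)
Definition set_min (S : set (\bar R)) : \bar R :=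
  xget +oo%E [set m | S m /\ lbound S m].

Definition geod_dist_sq_SO g F : \bar R :=
  set_min [set (geod_dist g F Q ^+ 2)%E | Q in SO R n].

End GeodesicDistance.

(* Main.v *)
Require Import Defs.
From mathcomp Require Import all_boot all_order all_algebra.
From mathcomp Require Import all_classical all_reals all_analysis.
From mathcomp Require Import perm measurable_realfun ring lra.
From mathcomp.real_closed Require complex.
Import Order.TTheory GRing.Theory Num.Theory.
Import numFieldNormedType.Exports.
Local Open Scope classical_set_scope.
Local Open Scope ring_scope.

Set Implicit Arguments.
Unset Strict Implicit.
Unset Printing Implicit Defensive.

(** Write F = R U and log U = Q^T diag(l) Q with Q orthogonal, and let |X| be
    the norm of a symmetric matrix X for the form mu <dev X, dev X> +
    (kappa / 2) (tr X)^2. The claim is that the distance from F to R is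
    |log U|, and that no rotation is closer.

    Upper bound. The curve F exp(- t log U), 0 <= t <= 1, goes from F to R with
    velocity c^-1 c' = - log U, which is constant and symmetric; so its length
    is |log U| ([exp_curve_length], [exp_curve_admissible]).

    Lower bound. No curve from F to an orthogonal matrix is shorter, because
    there is a calibrating function. For an invertible c let a_i(c) be the
    logarithm of the i-th diagonal entry of the Cholesky factor of c c^T, that
    is, half the logarithm of the quotient of two consecutive leading principal
    minors of c c^T. Along a curve, the derivative of a_i is the Frobenius
    product of sym(c^-1 c') with the projection on the i-th vector of the
    Gram-Schmidt frame of the rows of c. Hence, for fixed weights w, a suitable
    linear combination of the a_i (the function [potential]) has derivative
    <W, sym(c^-1 c')> in the inner product above, where W is the symmetric
    matrix with eigenvalues w_i along the frame ([is_derive_potential]). The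
    frame is orthonormal, so |W| depends on w only, and by Cauchy-Schwarz the
    derivative is at most |diag w| times the speed ([potential_speed_le]); the
    skew part of c^-1 c', which carries mu_c, only adds to the speed.
    Integration over the pieces of the curve bounds the increase of the
    potential by |diag w| times the length ([piecewise_potential_le]).

    After left translation by the orthogonal matrix Q R^T, which changes
    neither the speed nor orthogonality, a curve from F starts at diag(e^l) Q,
    where c c^T = diag(e^(2 l)), and ends where c c^T = 1. For w = - l the
    potential increases from - |diag l|^2 to 0, so |diag l|^2 is at most
    |diag l| times the length ([curve_length_ge]). In geometric terms, the
    a_i are horospherical coordinates of c c^T in the symmetric space of
    positive definite matrices.

    The square root and the logarithm exist by the spectral theorem for real
    symmetric matrices ([symmetric_spectral]). The two bounds hold for every
    symmetric L with exp L = U, so the choice of the logarithm is immaterial. *)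

(** * Spectral theorem for real symmetric matrices *)

Section Spectral.
Import complex.
Context {R : realType}.

(** A complex eigenvalue of a real symmetric matrix is real, since the matrix is
    Hermitian over the complex numbers; a real root of the characteristic
    polynomial then has a real eigenvector. *)
Lemma symmetric_eigenvector n (A : 'M[R]_n.+1) : A^T = A ->
  exists (a : R) (v : 'rV[R]_n.+1), v != 0 /\ v *m A = a *: v.
Proof.
move=> Asym.
pose rc := @complex.real_complex R.
have rcR x : rc x \is Num.real by rewrite complex.complex_real.
pose AC := map_mx rc A.
have AC_real : AC \is a mxOver Num.real.
  by apply/mxOverP => i j; rewrite mxE.
have ACs : AC \is symmetricmx.
  by apply/is_hermitianmxP; rewrite expr0 scale1r map_mx_id// /AC map_trmx Asym.
have hAC := realsym_hermsym ACs AC_real.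
have /orthomx_spectralP ACE := hermitian_normalmx hAC.
have /mxOverP/(_ 0 0) := hermitian_spectral_diag_real hAC.
move=> /complex.complex_realP[a aE].
have : eigenvalue AC (rc a).
  apply/eigenvalueP; exists (row 0 (spectralmx AC)).
    rewrite {2}ACE !mulmxA -!row_mul mulmxV ?spectral_unit// mul1mx.
    by rewrite row_mul row_diag_mx aE -scalemxAl -rowE.
  apply/negP => /eqP r0; have := row_free_unit (spectralmx AC).
  rewrite spectral_unit => /row_freeP[B] /(congr1 (row 0)).
  rewrite row_mul r0 mul0mx => /rowP/(_ 0); rewrite !mxE eqxx => /eqP.
  by rewrite eq_sym oner_eq0.
rewrite eigenvalue_root_char -map_char_poly fmorph_root -eigenvalue_root_char.
by move=> /eigenvalueP[v vA v0]; exists a, v.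
Qed.

Lemma self_dot_gt0 n (v : 'rV[R]_n) : v != 0 -> 0 < (v *m v^T) 0 0.
Proof.
move=> v0; rewrite mxE lt_neqAle sumr_ge0 ?andbT => [|i _]; last first.
  by rewrite mxE -expr2 sqr_ge0.
rewrite eq_sym psumr_eq0 => [|i _]; last by rewrite mxE -expr2 sqr_ge0.
apply: contra v0 => /allP h; apply/eqP/rowP => i; rewrite !mxE.
by apply/eqP; have := h i (mem_index_enum i); rewrite !mxE /= mulf_eq0 orbb.
Qed.

(** The Householder reflection that exchanges v and the first basis vector. *)
Lemma orthogonal_first_row n (v : 'rV[R]_n.+1) : v *m v^T = 1%:M ->
  exists2 H : 'M[R]_n.+1, H *m H^T = 1%:M & delta_mx 0 0 *m H = v.
Proof.
move=> vv; pose e : 'rV[R]_n.+1 := delta_mx 0 0.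
have [ve|ve] := eqVneq (v - e) 0.
  exists 1%:M; first by rewrite trmx1 mulmx1.
  by rewrite mulmx1; apply/esym/eqP; rewrite -subr_eq0 ve.
(* u is kept opaque so that distributivity does not expand it below. *)
have [u uE] : exists u, u = v - e by exists (v - e).
rewrite -uE in ve; pose s := (u *m u^T) 0 0.
have s0 : s != 0 by rewrite gt_eqF// self_dot_gt0.
have uu : u *m u^T = s%:M by rewrite [LHS]mx11_scalar.
have eu : e *m u^T = (- (s / 2))%:M.
  have ee : e *m e^T = 1%:M.
    by rewrite trmx_delta mul_delta_mx [LHS]mx11_scalar mxE eqxx.
  have ve' : v *m e^T = e *m v^T.
    by rewrite -[LHS]trmxK trmx_mul trmxK [LHS]mx11_scalar mxE -mx11_scalar.
  have : u *m u^T = - (e *m u^T) *+ 2.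
    rewrite uE linearB/= mulmxBl !mulmxBr vv ee ve' opprB.
    by rewrite mulr2n addrC.
  rewrite uu => /matrixP/(_ 0 0); rewrite mxE eqxx !mxE /= mulr1n => ->.
  rewrite [LHS]mx11_scalar; congr (_%:M); rewrite mxE /GRing.exp.
  by field.
pose H := 1%:M - (2 / s) *: (u^T *m u).
have HT : H^T = H.
  by rewrite /H linearB linearZ/= trmx1 trmx_mul trmxK.
exists H.
  rewrite HT /H mulmxBl mul1mx !mulmxBr mulmx1 -scalemxAl -scalemxAr.
  rewrite mulmxA -(mulmxA u^T) uu mul_mx_scalar -scalemxAl !scalerA.
  rewrite -addrA -opprD -scalerBl -scalerDl.
  rewrite (_ : 2 / s + _ = 0) ?scale0r ?subr0//.
  by field.
rewrite /H mulmxBr mulmx1 -scalemxAr mulmxA eu mul_scalar_mx scalerA.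
rewrite (_ : 2 / s * _ = -1); last by field.
by rewrite scaleN1r opprK uE addrC subrK.
Qed.

(** An orthogonal change of basis that takes the first basis vector to a unit
    eigenvector splits off a 1 x 1 block; the rest follows by induction. *)
Lemma symmetric_spectral n (A : 'M[R]_n) : A^T = A ->
  exists (O : 'M[R]_n) (d : 'rV[R]_n),
    O *m O^T = 1%:M /\ A = O^T *m diag_mx d *m O.
Proof.
elim: n A => [|n IH] A Asym.
  by exists 1%:M, 0; split; apply/matrixP => -[].
have [a [v0 [v0N0 v0A]]] := symmetric_eigenvector Asym.
have v0v0 := self_dot_gt0 v0N0.
pose v := (Num.sqrt ((v0 *m v0^T) 0 0))^-1 *: v0.
have vA : v *m A = a *: v by rewrite -scalemxAl v0A !scalerA mulrC.
have vv : v *m v^T = 1%:M.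
  rewrite /v linearZ/= -scalemxAl -scalemxAr scalerA -invfM -expr2 sqr_sqrtr ?ltW//.
  rewrite [LHS]mx11_scalar; congr (_%:M).
  by rewrite mxE mulVf ?gt_eqF.
pose e : 'rV[R]_n.+1 := delta_mx 0 0.
have [H HH eH] := orthogonal_first_row vv.
have [B BH] : exists B, B = H *m A *m H^T by exists (H *m A *m H^T).
have Bsym : B^T = B by rewrite BH !trmx_mul trmxK Asym mulmxA.
have eB : e *m B = a *: e.
  rewrite BH !mulmxA eH vA -scalemxAl -eH -mulmxA HH mulmx1 //.
have HtH : H^T *m H = 1%:M by apply: mulmx1C.
have AE : A = H^T *m B *m H.
  by rewrite BH !mulmxA HtH mul1mx -mulmxA HtH mulmx1.
have B0 j : B 0 j = a *+ (j == 0).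
  by have /rowP/(_ j) := eB; rewrite -rowE !mxE eqxx /= mulr_natr eq_sym.
pose B' : 'M[R]_n := @drsubmx _ 1 n 1 n B.
have BE : B = @block_mx R 1 n 1 n a%:M 0 0 B'.
  have l0 : lshift n (0 : 'I_1) = 0 :> 'I_n.+1 by apply/val_inj.
  have B0l : @ulsubmx _ 1 n 1 n B = a%:M.
    by apply/matrixP=> i j; rewrite !mxE !ord1 l0 B0.
  have B0r : @ursubmx _ 1 n 1 n B = 0.
    by apply/matrixP=> i j; rewrite !mxE !ord1 l0 B0.
  rewrite -[LHS](@submxK _ 1 n 1 n) B0l B0r -[dlsubmx _]trmxK trmx_dlsub Bsym.
  by rewrite B0r trmx0.
have [|O' [d' [OO BE']]] := IH B'; first by rewrite trmx_drsub Bsym.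
pose K : 'M[R]_n.+1 := @block_mx R 1 n 1 n 1%:M 0 0 O'.
pose d : 'rV[R]_n.+1 := @row_mx R 1 1 n a%:M d'.
have KK : K *m K^T = 1%:M.
  rewrite /K (@tr_block_mx _ 1 n 1 n) !trmx0 trmx1 (@mulmx_block _ 1 n 1 n 1 n).
  rewrite !mul0mx !mulmx0 mulmx1 OO addr0 !add0r.
  by rewrite -(@scalar_mx_block _ 1 n).
have KdK : K^T *m diag_mx d *m K = B.
  rewrite BE /d (@diag_mx_row _ n 1) /K (@tr_block_mx _ 1 n 1 n) !trmx0 trmx1.
  rewrite !(@mulmx_block _ 1 n 1 n 1 n).
  rewrite !(mul0mx, mulmx0, mul1mx, mulmx1, addr0, add0r) -BE'.
  suff -> : diag_mx (a%:M : 'rV_1) = a%:M by [].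
  by apply/matrixP => i j; rewrite !mxE !ord1 eqxx !mulr1n.
exists (K *m H), d; split.
  by rewrite trmx_mul mulmxA -(mulmxA K) HH mulmx1.
by rewrite trmx_mul AE -KdK !mulmxA.
Qed.
End Spectral.

(** * Limits and derivatives of matrix-valued functions *)

Section MatrixLimits.
Context {R : realType} {T : Type} (F : set_system T) {FF : Filter F}.

Lemma cvg_mxP m n (f : T -> 'M[R]_(m, n)) (A : 'M[R]_(m, n)) :
  f @ F --> A <-> forall i j, f x i j @[x --> F] --> A i j.
Proof.
split=> [fA i j|fA].
  exact: (@cvg_comp _ _ _ f (fun M : 'M[R]_(m, n) => M i j) F (nbhs A)
    (nbhs (A i j)) fA (@coord_continuous _ m n i j A)).
apply/cvgrPdist_le => /= e e0; near=> x.
rewrite /Num.Def.normr/= mx_normrE (bigmax_le _ (ltW e0))//= => i _.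
rewrite !mxE/=; move: i; near: x; apply: filter_forall => /= i.
exact: (cvgrPdist_le _ _).1 (fA i.1 i.2) _ e0.
Unshelve. all: by end_near. Qed.

Lemma cvg_bigsum I (r : seq I) (f : I -> T -> R) (a : I -> R) :
  (forall i, f i x @[x --> F] --> a i) ->
  \sum_(i <- r) f i x @[x --> F] --> \sum_(i <- r) a i.
Proof. by move=> fa; apply: cvg_big => //; exact: add_continuous. Qed.

Lemma cvg_bigprod I (r : seq I) (f : I -> T -> R) (a : I -> R) :
  (forall i, f i x @[x --> F] --> a i) ->
  \prod_(i <- r) f i x @[x --> F] --> \prod_(i <- r) a i.
Proof. by move=> fa; apply: cvg_big => //; exact: mul_continuous. Qed.

Lemma cvg_mulmx m n p (f : T -> 'M[R]_(m, n)) (g : T -> 'M[R]_(n, p))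
    (A : 'M[R]_(m, n)) (B : 'M[R]_(n, p)) :
  f @ F --> A -> g @ F --> B -> f x *m g x @[x --> F] --> A *m B.
Proof.
move=> /cvg_mxP fA /cvg_mxP gB; apply/cvg_mxP => i j; rewrite mxE.
by under eq_cvg do rewrite mxE; apply: cvg_bigsum => k; exact: cvgM.
Qed.

Lemma cvg_trmx m n (f : T -> 'M[R]_(m, n)) (A : 'M[R]_(m, n)) :
  f @ F --> A -> (f x)^T @[x --> F] --> A^T.
Proof.
move=> /cvg_mxP fA; apply/cvg_mxP => i j; rewrite mxE.
by under eq_cvg do rewrite mxE; exact: fA.
Qed.

Lemma cvg_mxtrace n (f : T -> 'M[R]_n) (A : 'M[R]_n) :
  f @ F --> A -> \tr (f x) @[x --> F] --> \tr A.
Proof. by move=> /cvg_mxP fA; apply: cvg_bigsum => i. Qed.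

Lemma cvg_det n (f : T -> 'M[R]_n) (A : 'M[R]_n) :
  f @ F --> A -> \det (f x) @[x --> F] --> \det A.
Proof.
move=> /cvg_mxP fA; apply: cvg_bigsum => s; apply: cvgM; first exact: cvg_cst.
by apply: cvg_bigprod => i.
Qed.

Lemma cvg_adjugate n (f : T -> 'M[R]_n) (A : 'M[R]_n) :
  f @ F --> A -> \adj (f x) @[x --> F] --> \adj A.
Proof.
move=> /cvg_mxP fA; apply/cvg_mxP => i j; rewrite mxE.
under eq_cvg do rewrite mxE; apply: cvgM; first exact: cvg_cst.
apply: cvg_det; apply/cvg_mxP => k l; rewrite !mxE.
by under eq_cvg do rewrite !mxE; exact: fA.
Qed.

Lemma cvg_invmx n (f : T -> 'M[R]_n) (A : 'M[R]_n) : A \in unitmx ->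
  (\forall x \near F, f x \in unitmx) ->
  f @ F --> A -> invmx (f x) @[x --> F] --> invmx A.
Proof.
move=> Au fu fA; rewrite /invmx Au.
have fE : \forall x \near F, (\det (f x))^-1 *: \adj (f x) = invmx (f x).
  by apply: filterS fu => x fxu; rewrite /invmx fxu.
apply: cvg_trans (near_eq_cvg fE) _.
apply: cvgZ; last exact: cvg_adjugate.
by apply: cvgV; [rewrite -unitfE -unitmxE|exact: cvg_det].
Qed.

End MatrixLimits.

Section MatrixDerivative.
Context {R : realType}.
Implicit Types (x : R).

Lemma is_derive_bigsum I (r : seq I) (f : I -> R -> R) (df : I -> R) x :
  (forall i, is_derive x 1 (f i) (df i)) ->
  is_derive x 1 (fun t => \sum_(i <- r) f i t) (\sum_(i <- r) df i).
Proof.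
move=> fdf; elim: r => [|i r IH].
  rewrite big_nil (_ : (fun _ => _) = cst 0); first exact: is_derive_cst.
  by apply/funext => t; rewrite big_nil.
rewrite big_cons (_ : (fun _ => _) = f i + (fun t => \sum_(i <- r) f i t)).
  exact: is_deriveD.
by apply/funext => t; rewrite big_cons.
Qed.

Lemma is_derive_bigprod (I : finType) (f : I -> R -> R) (df : I -> R) x :
  (forall i, is_derive x 1 (f i) (df i)) ->
  is_derive x 1 (fun t => \prod_i f i t)
    (\sum_i df i * \prod_(j | j != i) f j x).
Proof.
move=> fdf; elim: (index_enum I) (index_enum_uniq I) => [|i r IH] /=.
  move=> _; rewrite big_nil (_ : (fun _ => _) = cst 1); first exact: is_derive_cst.
  by apply/funext => t; rewrite big_nil.
move=> /andP[ir ru].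
rewrite (_ : (fun _ => _) = f i * (fun t => \prod_(i <- r) f i t)); last first.
  by apply/funext => t; rewrite big_cons.
apply: is_derive_eq; first by apply: is_deriveM (fdf i) (IH ru).
rewrite big_cons addrC; congr (_ + _).
  rewrite big_cons eqxx /= mulrC; congr (_ * _).
  rewrite [RHS]big_seq_cond [LHS]big_seq; apply: eq_bigl => j.
  by have [->|//] := eqVneq j i; rewrite ?(negbTE ir) ?andbT ?andbF.
rewrite /GRing.scale /= mulr_sumr; apply: eq_big_seq => j jr.
rewrite big_cons (_ : i != j); last by apply: contraNneq ir => ->.
by rewrite mulrCA.
Qed.

Lemma is_derive_mxP m n (f : R -> 'M[R]_(m, n)) (df : 'M[R]_(m, n)) x :
  is_derive x 1 f df <->
  forall i j, is_derive x 1 (fun t => f t i j) (df i j).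
Proof.
split=> [[fx <-] i j|fdf].
  by split; [move/derivable_mxP : fx|rewrite derive_mx// mxE].
have fx : derivable f x 1 by apply/derivable_mxP => i j; case: (fdf i j).
split=> //; rewrite derive_mx//; apply/matrixP => i j; rewrite mxE.
by case: (fdf i j).
Qed.

Lemma is_derive_mulmx m n p (f : R -> 'M[R]_(m, n)) (g : R -> 'M[R]_(n, p))
    df dg x :
  is_derive x 1 f df -> is_derive x 1 g dg ->
  is_derive x 1 (fun t => f t *m g t) (df *m g x + f x *m dg).
Proof.
move=> /is_derive_mxP fdf /is_derive_mxP gdg; apply/is_derive_mxP => i j.
rewrite (_ : (fun _ => _) = fun t => \sum_k (f t i k * g t k j)); last first.
  by apply/funext => t; rewrite mxE.
rewrite !mxE -big_split /=; apply: is_derive_bigsum => k.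
apply: (is_derive_eq (is_deriveM (fdf i k) (gdg k j))).
by rewrite /GRing.scale /= addrC; congr (_ + _); rewrite mulrC.
Qed.

Lemma is_derive_trmx m n (f : R -> 'M[R]_(m, n)) df x :
  is_derive x 1 f df -> is_derive x 1 (fun t => (f t)^T) df^T.
Proof.
move=> /is_derive_mxP fdf; apply/is_derive_mxP => i j; rewrite mxE.
by rewrite (_ : (fun _ => _) = (fun t => f t j i))//; apply/funext => t; rewrite mxE.
Qed.

(** Jacobi's formula. By the product rule, the derivative is the sum over i of the
    determinants in which row i is differentiated; each of them is expanded
    along that row. *)
Lemma is_derive_det n (f : R -> 'M[R]_n) (df : 'M[R]_n) x :
  is_derive x 1 f df ->
  is_derive x 1 (fun t => \det (f t)) (\tr (df *m \adj (f x))).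
Proof.
move=> /is_derive_mxP fdf.
have := @is_derive_bigsum _ (index_enum 'S_n)
  (fun s t => (-1) ^+ s * \prod_i f t i (s i))
  (fun s => (-1) ^+ s * (\sum_i df i (s i) * \prod_(j | j != i) f x j (s j))) x.
rewrite /determinant => H; apply: is_derive_eq; first apply: H => s.
  have := is_deriveZ ((-1) ^+ s) (is_derive_bigprod (fun i => fdf i (s i))).
  by [].
under eq_bigr do rewrite mulr_sumr.
rewrite exchange_big /=; apply: eq_bigr => i _.
pose N := \matrix_(k, j) (if k == i then df k j else f x k j).
transitivity (\det N).
  apply: eq_bigr => s _; congr (_ * _).
  rewrite [RHS](bigD1 i) //= mxE eqxx; congr (_ * _).
  by apply: eq_bigr => j /negbTE ji; rewrite mxE ji.
rewrite (expand_det_row _ i) mxE; apply: eq_bigr => j _.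
rewrite !mxE eqxx; congr (_ * (_ * \det _)).
by apply/matrixP => k l; rewrite !mxE eq_sym (negbTE (neq_lift _ _)).
Qed.

End MatrixDerivative.

(** * Square root, exponential and logarithm through the spectral theorem *)

Section SpectralCalculus.
Context {R : realType} {n : nat}.
Implicit Types (Q A U : 'M[R]_n) (d : 'rV[R]_n).

Lemma expmx_spectral Q d k : Q *m Q^T = 1%:M ->
  (Q^T *m diag_mx d *m Q) ^+ k = Q^T *m diag_mx (map_mx (fun x => x ^+ k) d) *m Q.
Proof.
move=> QQ; have QQ' := mulmx1C QQ; elim: k => [|k IH].
  rewrite expr0 (_ : map_mx _ _ = const_mx 1) ?diag_const_mx ?mulmx1 ?QQ' //.
  by apply/rowP => i; rewrite !mxE expr0.
rewrite exprS IH -[_ * _]/(_ *m _) !mulmxA -(mulmxA _ Q) QQ mulmx1.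
rewrite -(mulmxA Q^T) mulmx_diag; congr (_ *m diag_mx _ *m _).
by apply/rowP => i; rewrite !mxE exprS.
Qed.

Lemma mexp_spectral Q d : Q *m Q^T = 1%:M ->
  mexp (Q^T *m diag_mx d *m Q) = Q^T *m diag_mx (map_mx expR d) *m Q.
Proof.
move=> QQ; apply/cvg_lim => //.
rewrite (_ : series _ = fun N =>
    Q^T *m diag_mx (\row_i series (exp_coeff (d 0 i)) N) *m Q); last first.
  apply/funext => N; rewrite /series/=.
  rewrite (_ : diag_mx (\row_i _) = \sum_(0 <= k < N)
      k`!%:R^-1 *: diag_mx (map_mx (fun x => x ^+ k) d)).
    rewrite mulmx_sumr mulmx_suml; apply: eq_bigr => k _.
    by rewrite expmx_spectral// -scalemxAr -scalemxAl.
  apply/matrixP => i j; rewrite summxE !mxE -sumrMnl; apply: eq_bigr => k _.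
  by rewrite !mxE /exp_coeff /= mulrnAr mulrC.
apply: cvg_mulmx; last exact: cvg_cst.
apply: cvg_mulmx; first exact: cvg_cst.
apply/cvg_mxP => i j; rewrite !mxE; under eq_cvg do rewrite !mxE.
by apply: cvgMn; exact: is_cvg_series_exp_coeff.
Qed.

Lemma spd_spectral Q d : Q *m Q^T = 1%:M -> (forall i, 0 < d 0 i) ->
  spd (Q^T *m diag_mx d *m Q).
Proof.
move=> QQ d0; split; first by rewrite !trmx_mul trmxK tr_diag_mx mulmxA.
move=> v v0; rewrite !mulmxA -!(mulmxA _ Q) -trmx_mul.
have : Q *m v != 0.
  apply: contra v0 => /eqP Ov.
  by rewrite -[v]mul1mx -(mulmx1C QQ) -mulmxA Ov mulmx0.
move: (Q *m v) => w w0; rewrite mul_mx_diag mxE.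
have wd i : (\matrix_(i0, j) (w^T i0 j * d 0 j)) 0 i * w i 0 = d 0 i * w i 0 ^+ 2.
  by rewrite !mxE mulrAC -expr2 mulrC.
rewrite (eq_bigr _ (fun i _ => wd i)) lt_neqAle sumr_ge0 ?andbT; last first.
  by move=> i _; rewrite mulr_ge0 ?sqr_ge0 ?ltW.
rewrite eq_sym psumr_eq0; last by move=> i _; rewrite mulr_ge0 ?sqr_ge0 ?ltW.
apply: contra w0 => /allP h; apply/eqP/colP => i; rewrite !mxE.
have := h i (mem_index_enum i); rewrite /= mulf_eq0 (gt_eqF (d0 i)) /=.
by rewrite sqrf_eq0 => /eqP.
Qed.

Lemma spd_spectral_inv A : spd A ->
  exists Q d, [/\ Q *m Q^T = 1%:M, forall i, 0 < d 0 i &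
                  A = Q^T *m diag_mx d *m Q].
Proof.
move=> [As Ap]; have [Q [d [QQ AE]]] := symmetric_spectral As.
exists Q, d; split=> // i.
have := Ap (Q^T *m delta_mx i 0).
rewrite AE trmx_mul trmxK -!mulmxA !(mulmxA Q Q^T) QQ !mul1mx.
rewrite (_ : (_ *m (diag_mx d *m _)) 0 0 = d 0 i); last first.
  by rewrite trmx_delta -colE -rowE !mxE eqxx mulr1n.
apply; apply/negP => /eqP h.
have : Q *m (Q^T *m delta_mx i 0) = 0 :> 'cV[R]_n by rewrite h mulmx0.
rewrite mulmxA QQ mul1mx => /colP/(_ i); rewrite !mxE !eqxx => /eqP.
by rewrite oner_eq0.
Qed.

Lemma spd_det_gt0 A : spd A -> 0 < \det A.
Proof.
move=> /spd_spectral_inv[Q [d [QQ d0 ->]]].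
rewrite !det_mulmx mulrAC -det_mulmx (mulmx1C QQ) det1 mul1r det_diag.
by apply: prodr_gt0 => i _; exact: d0.
Qed.

Lemma spd_unit A : spd A -> A \in unitmx.
Proof. by move=> /spd_det_gt0 A0; rewrite unitmxE unitfE gt_eqF. Qed.

(** The quadratic form at v is |X v|^2 + |Y v|^2. *)
Lemma sumsq_spd (X Y : 'M[R]_n) :
  (forall v : 'cV[R]_n, X *m v = 0 -> Y *m v = 0 -> v = 0) ->
  spd (X^T *m X + Y^T *m Y).
Proof.
move=> XY; split; first by rewrite linearD /= !trmx_mul !trmxK.
have dot0 (w : 'cV[R]_n) : 0 <= (w^T *m w) 0 0 ?= iff (w == 0).
  split.
    by rewrite mxE sumr_ge0// => i _; rewrite mxE -expr2 sqr_ge0.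
  apply/eqP/eqP => [w0|->]; last by rewrite mulmx0 mxE.
  apply: contraPeq w0 => w0; apply/eqP; rewrite eq_sym gt_eqF//.
  have := @self_dot_gt0 R n w^T; rewrite trmxK; apply.
  by apply: contra w0 => /eqP w0; rewrite -[w]trmxK w0 trmx0.
move=> v v0; rewrite mulmxDr mulmxDl mxE !mulmxA -!trmx_mul -!(mulmxA _ _ v).
rewrite lt_neqAle addr_ge0 ?(dot0 _).1// andbT eq_sym paddr_eq0 ?(dot0 _).1//.
rewrite ![_ 0 0 == 0]eq_sym !(dot0 _).2; apply/negP => /andP[/eqP Xv /eqP Yv].
by move: v0; rewrite (XY v Xv Yv) eqxx.
Qed.

(** [msqrt] selects some positive definite square root of its argument, so it is
    enough to exhibit one. *)
Lemma msqrtP A : spd A -> spd (msqrt A) /\ msqrt A *m msqrt A = A.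
Proof.
move=> /spd_spectral_inv[Q [d [QQ d0 ->]]].
set A0 := (X in msqrt X).
suff : exists U, (spd U /\ U *m U = A0) by move=> /(xgetPex 0).
exists (Q^T *m diag_mx (map_mx Num.sqrt d) *m Q); split.
  by apply: spd_spectral => // i; rewrite mxE sqrtr_gt0.
rewrite !mulmxA -(mulmxA _ Q) QQ mulmx1 -(mulmxA Q^T) mulmx_diag.
congr (_ *m diag_mx _ *m _).
by apply/rowP => i; rewrite !mxE -expr2 sqr_sqrtr// ltW.
Qed.

(** [mlog] selects some symmetric logarithm of its argument, so it is enough to
    exhibit one. *)
Lemma mlogP U : spd U -> (mlog U)^T = mlog U /\ mexp (mlog U) = U.
Proof.
move=> /spd_spectral_inv[Q [d [QQ d0 ->]]].
set A0 := (X in mlog X).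
suff : exists L, (L^T = L /\ mexp L = A0) by move=> /(xgetPex 0).
exists (Q^T *m diag_mx (map_mx (@ln R) d) *m Q); split.
  by rewrite !trmx_mul trmxK tr_diag_mx mulmxA.
rewrite mexp_spectral//; congr (_ *m diag_mx _ *m _).
by apply/rowP => i; rewrite !mxE lnK ?posrE.
Qed.

End SpectralCalculus.

(** * The invariant inner product *)

Section Moduli.
Context {R : realType} {n : nat}.
Implicit Types (A X Y Z : 'M[R]_n) (mu mu_c kappa : R).

(** The part of the inner product that acts on symmetric matrices; the limiting
    case of a vanishing spin modulus. *)
Definition strain_form mu kappa X Y : R :=
  mu * frob (dev X) (dev Y) + kappa / 2 * (\tr X * \tr Y).

Lemma frobDr X Y Z : frob X (Y + Z) = frob X Y + frob X Z.
Proof. by rewrite /frob mulmxDr linearD. Qed.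

Lemma frobZr a X Y : frob X (a *: Y) = a * frob X Y.
Proof. by rewrite /frob -scalemxAr linearZ. Qed.

Lemma frobBr X Y Z : frob X (Y - Z) = frob X Y - frob X Z.
Proof. by rewrite frobDr -scaleN1r frobZr mulN1r. Qed.

Lemma frobC X Y : frob X Y = frob Y X.
Proof. by rewrite /frob -mxtrace_tr trmx_mul trmxK. Qed.

Lemma frob_ge0 X : 0 <= frob X X.
Proof.
rewrite /frob /mxtrace sumr_ge0// => i _; rewrite mxE sumr_ge0// => j _.
by rewrite mxE -expr2 sqr_ge0.
Qed.

Lemma frob1l X : frob 1%:M X = \tr X.
Proof. by rewrite /frob trmx1 mul1mx. Qed.

Lemma frob_dev X Y : (0 < n)%N ->
  frob (dev X) (dev Y) = frob X Y - n%:R^-1 * (\tr X * \tr Y).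
Proof.
move=> n0; have nn : n%:R != 0 :> R by rewrite pnatr_eq0 -lt0n.
rewrite /frob /dev [(X - _)^T]linearB/= tr_scalar_mx mulmxBl !mulmxBr !mul_scalar_mx.
rewrite mul_mx_scalar !linearB/= !linearZ/= mxtrace_tr mxtrace_scalar /GRing.scale /=.
by field.
Qed.

Lemma strain_formE mu kappa X Y : (0 < n)%N ->
  strain_form mu kappa X Y =
  mu * frob X Y + (kappa / 2 - mu / n%:R) * (\tr X * \tr Y).
Proof. by move=> n0; rewrite /strain_form frob_dev//; ring. Qed.

Lemma strain_form_ge0 mu kappa X : 0 <= mu -> 0 <= kappa ->
  0 <= strain_form mu kappa X X.
Proof.
move=> mu0 k0; apply: addr_ge0; first by rewrite mulr_ge0// frob_ge0.
by rewrite mulr_ge0 ?divr_ge0// -expr2 sqr_ge0.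
Qed.

(** The form is positive, so the quadratic polynomial t |-> q (Y + t X, Y + t X)
    has nonpositive discriminant. *)
Lemma strain_form_CauchySchwarz mu kappa X Y : (0 < n)%N ->
  0 <= mu -> 0 <= kappa ->
  strain_form mu kappa X Y <=
  Num.sqrt (strain_form mu kappa X X) * Num.sqrt (strain_form mu kappa Y Y).
Proof.
move=> n0 mu0 k0; set q := strain_form mu kappa.
have qD t : q (Y + t *: X) (Y + t *: X) = q X X * t ^+ 2 + (2 * q X Y) * t + q Y Y.
  rewrite /q !strain_formE// frobDr (frobC _ Y) (frobC _ (t *: X)) !frobDr.
  rewrite !frobZr !(frobC (t *: X)) !frobZr !linearD !linearZ/= (frobC Y X).
  by ring.
have := @deg_le2_poly_delta_ge0 _ (Poly [:: q Y Y; 2 * q X Y; q X X]) (size_Poly _).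
rewrite !coef_Poly /= => /(_ (strain_form_ge0 _ mu0 k0)) H.
have {}H : q X Y ^+ 2 <= q X X * q Y Y.
  have /H : forall t, 0 <= (Poly [:: q Y Y; 2 * q X Y; q X X]).[t].
    move=> t; suff -> : (Poly [:: q Y Y; 2 * q X Y; q X X]).[t] =
        q (Y + t *: X) (Y + t *: X) by exact: strain_form_ge0.
    by rewrite qD horner_Poly /=; ring.
  by move=> H4; nra.
rewrite -sqrtrM ?strain_form_ge0// (le_trans (ler_norm _))//.
by rewrite -sqrtr_sqr ler_sqrt// mulr_ge0 // strain_form_ge0.
Qed.

(** The spin term is nonnegative. This is where the spin modulus disappears from
    the lower bound. *)
Lemma inner_ge_strain_form mu mu_c kappa X : 0 <= mu_c ->
  strain_form mu kappa (symm X) (symm X) <= inner mu mu_c kappa X X.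
Proof.
move=> c0; rewrite /inner /strain_form -addrA lerD2l.
have -> : \tr (symm X) = \tr X.
  by rewrite /symm linearZ linearD/= mxtrace_tr; field.
by rewrite lerDr mulr_ge0// frob_ge0.
Qed.

Lemma inner_symmetric mu mu_c kappa X : X^T = X ->
  inner mu mu_c kappa X X = strain_form mu kappa X X.
Proof.
move=> Xs; rewrite /inner /strain_form.
have -> : symm X = X.
  by rewrite /symm Xs -mulr2n -[X *+ 2]scaler_nat scalerA mulVf ?scale1r ?pnatr_eq0.
have -> : Defs.skew X = 0 by rewrite /Defs.skew Xs subrr scaler0.
by rewrite [X in mu_c * X]/frob trmx0 mul0mx linear0 mulr0 addr0.
Qed.

End Moduli.

(** * Leading minors and nested row projections *)

Section LeadingMinors.
Context {R : realType} {n : nat}.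
Implicit Types (c X B : 'M[R]_n) (i j k : nat).

Local Notation E k := (@pid_mx R n n k).

(** The leading k x k block of B, completed by an identity block. It has the
    leading principal minor of order k as determinant, while all the orders k
    live in the same matrix space. *)
Definition gram k B : 'M[R]_n :=
  pid_mx k *m B *m pid_mx k + (1%:M - pid_mx k).

(** For invertible c, the orthogonal projection onto the span of the first k
    rows. *)
Definition row_proj k c : 'M[R]_n :=
  c^T *m pid_mx k *m invmx (gram k (c *m c^T)) *m pid_mx k *m c.

Lemma tr_pid_sq k : (E k)^T = E k. Proof. exact: tr_pid_mx. Qed.

Lemma pid_mx_nested j k : (j <= k)%N -> E j *m E k = E j.
Proof. by move=> jk; rewrite mul_pid_mx (minn_idPl jk) pid_mx_minv. Qed.

Lemma gram_spd k c : c \in unitmx -> spd (gram k (c *m c^T)).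
Proof.
move=> cu; have -> : gram k (c *m c^T) =
    (c^T *m E k)^T *m (c^T *m E k) + (1%:M - E k)^T *m (1%:M - E k).
  rewrite /gram trmx_mul trmxK tr_pid_sq !mulmxA; congr (_ + _).
  rewrite [(_ - _)^T]linearB/= tr_pid_sq trmx1 mulmxBr mulmx1 mulmxBl mul1mx.
  by rewrite pid_mx_nested// subrr subr0.
apply: sumsq_spd => v; rewrite -mulmxA => cEv.
have Ev : E k *m v = 0.
  have cTu : c^T \in unitmx by rewrite unitmx_tr.
  by rewrite -[LHS](mulKmx cTu) cEv mulmx0.
by rewrite mulmxBl mul1mx Ev subr0.
Qed.

Lemma gram_unit k c : c \in unitmx -> gram k (c *m c^T) \in unitmx.
Proof. by move=> cu; exact/spd_unit/gram_spd. Qed.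

Lemma pid_gram k B : E k *m gram k B = E k *m B *m E k.
Proof.
by rewrite /gram mulmxDr !mulmxA pid_mx_nested// mulmxBr mulmx1 pid_mx_nested// subrr addr0.
Qed.

Lemma gram_pid k B : gram k B *m E k = E k *m B *m E k.
Proof.
by rewrite /gram mulmxDl -!mulmxA pid_mx_nested// mulmxBl mul1mx pid_mx_nested// subrr addr0.
Qed.

Lemma row_proj_sym k c : (row_proj k c)^T = row_proj k c.
Proof.
have Gs : (gram k (c *m c^T))^T = gram k (c *m c^T).
  rewrite /gram linearD linearB/= !trmx_mul trmxK !tr_pid_sq trmx1.
  by rewrite !mulmxA.
by rewrite /row_proj !trmx_mul !trmxK trmx_inv Gs !tr_pid_sq !mulmxA.
Qed.

(** The spans of the first rows increase with their number. *)
Lemma row_proj_nested j k c : c \in unitmx -> (j <= k)%N ->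
  row_proj j c *m row_proj k c = row_proj j c.
Proof.
move=> cu jk; rewrite /row_proj.
set Gj := invmx (gram j _); set Gk := invmx (gram k _).
have Gku := gram_unit k cu.
(* E j = E j E k, so E j (c c^T) E k = E j gram k, which Gk cancels. *)
suff H : E j *m (c *m c^T) *m E k *m Gk *m E k = E j.
  rewrite -[X in _ = _ *m X *m c]H.
  by rewrite !mulmxA.
rewrite (_ : E j *m _ *m E k = E j *m (E k *m (c *m c^T) *m E k)).
  by rewrite -pid_gram mulmxA pid_mx_nested// mulmxK// pid_mx_nested.
by rewrite !mulmxA pid_mx_nested.
Qed.

(** The trace of a projection is its rank. *)
Lemma tr_row_proj k c : c \in unitmx -> (k <= n)%N ->
  \tr (row_proj k c) = k%:R.
Proof.
move=> cu kn; have Gu := gram_unit k cu.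
rewrite /row_proj -mulmxA mxtrace_mulC -mulmxA -[E k *m c *m _]mulmxA.
rewrite (mulmxA c) (mulmxA (c *m _)) mulmxA mulmxA -gram_pid -mulmxA.
rewrite mxtrace_mulC -mulmxA mulVmx// mulmx1.
rewrite /mxtrace (eq_bigr (fun i : 'I_n => (i < k)%N%:R)) => [|i _].
  rewrite -natr_sum; congr (_%:R).
  rewrite -[RHS]card_ord -sum1_card (big_ord_widen n (fun=> 1%N) kn).
  by rewrite [RHS]big_mkcond.
by rewrite mxE eqxx.
Qed.

Lemma row_proj0 c : row_proj 0 c = 0.
Proof. by rewrite /row_proj pid_mx_0 mulmx0 !mul0mx. Qed.

Lemma row_projn c : c \in unitmx -> row_proj n c = 1%:M.
Proof.
move=> cu; rewrite /row_proj /gram pid_mx_1 !mulmx1 mul1mx subrr addr0.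
have cu' : c *m c^T \in unitmx by rewrite unitmx_mul cu unitmx_tr.
by apply: (can_inj (mulKmx cu)); rewrite mulmx1 !mulmxA mulmxV// mul1mx.
Qed.

End LeadingMinors.

(** * The potential and its derivative *)

Section Frame.
Context {R : realType} {n : nat}.
Implicit Types (c X B : 'M[R]_n) (i j k : nat) (w l : 'rV[R]_n).

Lemma minn_second_difference i j :
  (minn i.+1 j.+1 + minn i j = minn i.+1 j + minn i j.+1 + (i == j))%N.
Proof.
elim: i j => [|i IH] [|j]; rewrite ?minn0 ?min0n ?minnSS ?min0n// eqSS.
by move: (IH j); rewrite !minnSS !addSn !addnS => ->; rewrite !addSn.
Qed.

Lemma frob_row_proj j k c : c \in unitmx -> (j <= n)%N -> (k <= n)%N ->
  frob (row_proj j c) (row_proj k c) = (minn j k)%:R.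
Proof.
move=> cu jn kn; wlog jk : j k jn kn / (j <= k)%N => [H|].
  have /orP[jk|kj] := leq_total j k; first exact: H.
  by rewrite frobC minnC; exact: H.
by rewrite /frob row_proj_sym row_proj_nested// tr_row_proj// (minn_idPl jk).
Qed.

(** Projection onto the line of the i-th vector that the Gram-Schmidt process
    produces from the rows of c. *)
Definition axis_proj i c : 'M[R]_n := row_proj i.+1 c - row_proj i c.

(** The Gram-Schmidt lines are orthogonal: this is the second difference of
    <P_j, P_k> = min(j, k), where P_k is the projection onto the first k rows. *)
Lemma frob_axis_proj (i j : 'I_n) c : c \in unitmx ->
  frob (axis_proj i c) (axis_proj j c) = (i == j)%:R.
Proof.
move=> cu; rewrite /axis_proj frobBr !(frobC (_ - _)) !frobBr.
rewrite !frob_row_proj ?(ltnW (ltn_ord _))//.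
have /(congr1 (fun m => m%:R : R)) := minn_second_difference i j.
rewrite !natrD val_eqE (minnC j) (minnC j.+1 i) => H.
by rewrite (minnC j.+1) (minnC j); lra.
Qed.

Lemma sum_axis_proj c : c \in unitmx -> \sum_(i < n) axis_proj i c = 1%:M.
Proof.
move=> cu; rewrite -(big_mkord xpredT (fun i => axis_proj i c)).
by rewrite telescope_sumr// row_projn// row_proj0 subr0.
Qed.

(** For invertible c, the symmetric matrix with eigenvalue w_i along the i-th line
    of the Gram-Schmidt frame of the rows. *)
Definition frame_mx w c : 'M[R]_n := \sum_(i < n) w 0 i *: axis_proj i c.

Lemma frob_frame_mxl w c X :
  frob (frame_mx w c) X = \sum_(i < n) w 0 i * frob (axis_proj i c) X.
Proof.
rewrite /frob /frame_mx raddf_sum mulmx_suml raddf_sum; apply: eq_bigr => i _.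
by rewrite /= linearZ /= -scalemxAl linearZ.
Qed.

Lemma tr_frame_mx w c : c \in unitmx -> \tr (frame_mx w c) = \sum_i w 0 i.
Proof.
move=> cu; rewrite /frame_mx raddf_sum /=; apply: eq_bigr => i _.
rewrite linearZ /= linearB /= !tr_row_proj ?(ltnW (ltn_ord i))//.
by rewrite -natrB// subSnn mulr1.
Qed.

Lemma frob_frame_mx w c : c \in unitmx ->
  frob (frame_mx w c) (frame_mx w c) = \sum_i w 0 i ^+ 2.
Proof.
move=> cu; rewrite frob_frame_mxl; apply: eq_bigr => i _.
rewrite frobC frob_frame_mxl (bigD1 i)//= frob_axis_proj// eqxx mulr1 big1 ?addr0//.
by move=> j ji; rewrite frob_axis_proj// (negbTE ji) mulr0.
Qed.

Lemma frob_diag_mx w l : frob (diag_mx w) (diag_mx l) = \sum_i w 0 i * l 0 i.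
Proof.
rewrite /frob tr_diag_mx mulmx_diag mxtrace_diag; apply: eq_bigr => i _.
by rewrite mxE.
Qed.

Section Potential.
Local Notation E k := (@pid_mx R n n k).
Variables (mu kappa : R) (hn : (0 < n)%N).

(** The frame is orthonormal, so [frame_mx w c] is orthogonally similar to
    [diag_mx w]. *)
Lemma strain_form_frame_mx w c : c \in unitmx ->
  strain_form mu kappa (frame_mx w c) (frame_mx w c) =
  strain_form mu kappa (diag_mx w) (diag_mx w).
Proof.
move=> cu; rewrite !strain_formE// frob_frame_mx// tr_frame_mx//.
by rewrite frob_diag_mx mxtrace_diag.
Qed.

(** Diagonal entries of the matrix that represents [strain_form] against
    [diag_mx w] in the Frobenius product. *)
Definition stress w (i : 'I_n) : R :=
  mu * w 0 i + (kappa / 2 - mu / n%:R) * \sum_j w 0 j.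

Lemma strain_form_frame_mxl w c X : c \in unitmx ->
  strain_form mu kappa (frame_mx w c) X =
  \sum_(i < n) stress w i * frob (axis_proj i c) X.
Proof.
move=> cu; rewrite strain_formE// frob_frame_mxl tr_frame_mx//.
rewrite -[\tr X]frob1l -(sum_axis_proj cu) /stress.
rewrite (_ : frob (\sum_i _) X = \sum_(i < n) frob (axis_proj i c) X); last first.
  rewrite /frob raddf_sum mulmx_suml raddf_sum; exact: eq_bigr.
rewrite mulr_sumr mulrA mulr_sumr -big_split /=; apply: eq_bigr => i _.
by ring.
Qed.

(** Sum of the logarithms of the first k diagonal entries of the Cholesky factor
    of c c^T. *)
Definition half_ln_minor k c : R := 2^-1 * ln (\det (gram k (c *m c^T))).

(** Linear combination of the logarithms of the diagonal entries of the Cholesky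
    factor of c c^T. The weights make its gradient the frame matrix of w for the
    form [strain_form]. *)
Definition potential w c : R :=
  \sum_(i < n) stress w i * (half_ln_minor i.+1 c - half_ln_minor i c).

(** With X = c^-1 c', the derivative of c c^T is 2 c sym(X) c^T. Jacobi's formula
    and a cyclic permutation under the trace turn the derivative into the
    Frobenius product of sym(X) with the projection onto the first k rows. *)
Lemma is_derive_half_ln_minor k (c : R -> 'M[R]_n) v t : c t \in unitmx ->
  is_derive t 1 c v ->
  is_derive t 1 (fun s => half_ln_minor k (c s))
    (frob (row_proj k (c t)) (symm (invmx (c t) *m v))).
Proof.
move=> cu cv; pose B s := c s *m (c s)^T.
pose dB := v *m (c t)^T + c t *m v^T.
have Bd : is_derive t 1 B dB by apply: is_derive_mulmx => //; exact: is_derive_trmx.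
have Gd : is_derive t 1 (fun s => gram k (B s)) (E k *m dB *m E k).
  have dEB : is_derive t 1 (fun s => E k *m B s) (E k *m dB).
    have := is_derive_mulmx (is_derive_cst (E k) t 1) Bd.
    by rewrite mul0mx add0r.
  have dEBE : is_derive t 1 (fun s => E k *m B s *m E k)
      (E k *m dB *m E k).
    have := is_derive_mulmx dEB (is_derive_cst (E k) t 1).
    by rewrite mulmx0 addr0.
  have := is_deriveD dEBE (is_derive_cst (1%:M - E k) t 1).
  by rewrite addr0.
have Gp := spd_det_gt0 (gram_spd k cu).
have Gu := gram_unit k cu.
apply: (is_derive_eq (is_deriveZ (2^-1)
  (is_derive1_comp (is_derive1_ln Gp) (is_derive_det Gd)))).
rewrite /GRing.scale /=.
set G := gram k _ in Gu Gp *.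
have -> : (\det G)^-1 * \tr (E k *m dB *m E k *m \adj G) =
    \tr (E k *m dB *m E k *m invmx G).
  by rewrite /invmx Gu -scalemxAr linearZ.
rewrite /frob row_proj_sym /row_proj -/G /symm.
set X := invmx (c t) *m v; have vX : v = c t *m X by rewrite mulKVmx.
rewrite -scalemxAr linearZ /=; congr (_ * _).
(* Substituting c' = c X leaves only the symmetric part of X. *)
have dBE : dB = c t *m (X + X^T) *m (c t)^T.
  by rewrite /dB vX trmx_mul mulmxDr mulmxDl !mulmxA.
rewrite -!mulmxA [RHS]mxtrace_mulC -!mulmxA (mulmxA (c t)) -dBE.
by rewrite [LHS]mxtrace_mulC !mulmxA [RHS]mxtrace_mulC !mulmxA.
Qed.

Lemma is_derive_potential w (c : R -> 'M[R]_n) v t : c t \in unitmx ->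
  is_derive t 1 c v ->
  is_derive t 1 (fun s => potential w (c s))
    (strain_form mu kappa (frame_mx w (c t)) (symm (invmx (c t) *m v))).
Proof.
move=> cu cv; rewrite strain_form_frame_mxl//; apply: is_derive_bigsum => i.
have d k := is_derive_half_ln_minor k cu cv.
rewrite frobC /axis_proj frobBr !(frobC _ (row_proj _ _)).
have H := is_deriveZ (stress w i) (is_deriveB (d i.+1) (d i)).
by apply: is_derive_eq H _.
Qed.

Lemma half_ln_minor_diag k c l :
  c *m c^T = diag_mx (map_mx (fun x => expR (2 * x)) l) ->
  half_ln_minor k c = \sum_(i < n | (i < k)%N) l 0 i.
Proof.
move=> ccT; rewrite /half_ln_minor ccT.
rewrite (_ : gram k _ = diag_mx (\row_i expR (if (i < k)%N then 2 * l 0 i else 0))).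
  rewrite det_diag (eq_bigr (fun i : 'I_n => expR (if (i < k)%N then 2 * l 0 i else 0))).
    by rewrite -expR_sum expRK -big_mkcond -mulr_sumr mulKf// pnatr_eq0.
  by move=> i _; rewrite mxE.
have Ed : E k = diag_mx (\row_(i < n) (i < k)%N%:R).
  by apply/matrixP => i j; rewrite !mxE -mulnb natrM mulr_natl mulrb;
    case: (i == j) ; case: (i < k)%N.
rewrite /gram Ed !mulmx_diag -diag_const_mx -raddfB -raddfD; congr diag_mx.
apply/rowP => i; rewrite !mxE.
by case: ifP => _; rewrite ?expR0
  !(mulr0, mul0r, mulr1, mul1r, subr0, subrr, add0r, addr0).
Qed.

Lemma potential_diag w c l :
  c *m c^T = diag_mx (map_mx (fun x => expR (2 * x)) l) ->
  potential w c = strain_form mu kappa (diag_mx w) (diag_mx l).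
Proof.
move=> ccT; rewrite strain_formE// frob_diag_mx !mxtrace_diag /potential.
rewrite mulrA !mulr_sumr -big_split /=; apply: eq_bigr => i _.
rewrite !(half_ln_minor_diag _ ccT).
rewrite (bigD1 i) ?ltnS//= (eq_bigl (fun j : 'I_n => (j < i)%N)) => [|j].
  by rewrite addrK /stress -mulr_sumr; ring.
by rewrite ltnS [in RHS]ltn_neqAle andbC.
Qed.
End Potential.
End Frame.

(** * Continuity of the potential *)

Section Limits.
Context {R : realType} {n : nat} {T : Type} (F : set_system T) {FF : Filter F}.
Implicit Types (f h : T -> 'M[R]_n) (A B : 'M[R]_n).

Lemma cvg_frob f h A B : f @ F --> A -> h @ F --> B ->
  frob (f x) (h x) @[x --> F] --> frob A B.
Proof.
by move=> fA hB; apply: cvg_mxtrace; apply: cvg_mulmx => //; exact: cvg_trmx.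
Qed.

Lemma cvg_symm f A : f @ F --> A -> symm (f x) @[x --> F] --> symm A.
Proof.
move=> fA; apply: cvgZl_tmp.
by apply: cvgD; [exact: fA|exact: (cvg_trmx fA)].
Qed.

Lemma cvg_skew f A : f @ F --> A -> Defs.skew (f x) @[x --> F] --> Defs.skew A.
Proof.
move=> fA; apply: cvgZl_tmp.
by apply: cvgB; [exact: fA|exact: (cvg_trmx fA)].
Qed.

Lemma cvg_dev f A : f @ F --> A -> dev (f x) @[x --> F] --> dev A.
Proof.
move=> fA; apply: cvgB => //; rewrite -scalemx1; under eq_cvg do rewrite -scalemx1.
by apply: cvgZr_tmp; apply: cvgM; [exact: cvg_cst|exact: cvg_mxtrace].
Qed.

Lemma cvg_inner mu mu_c kappa f A : f @ F --> A ->
  inner mu mu_c kappa (f x) (f x) @[x --> F] --> inner mu mu_c kappa A A.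
Proof.
move=> fA; have tA : \tr (f x) @[x --> F] --> \tr A by exact: cvg_mxtrace.
have sA := cvg_symm fA; have kA := cvg_skew fA.
have dA := cvg_dev sA.
apply: cvgD; last by apply: cvgM; [exact: cvg_cst|exact: cvgM].
by apply: cvgD; (apply: cvgM; first exact: cvg_cst); exact: cvg_frob.
Qed.

Lemma cvg_gram k f A : f @ F --> A -> gram k (f x) @[x --> F] --> gram k A.
Proof.
move=> fA; apply: cvgD; last exact: cvg_cst.
by apply: cvg_mulmx; [apply: cvg_mulmx => //|]; exact: cvg_cst.
Qed.

Section Unit.
Variables (f : T -> 'M[R]_n) (A : 'M[R]_n).
Hypotheses (Au : A \in unitmx) (fu : \forall x \near F, f x \in unitmx).
Hypothesis fA : f @ F --> A.

Lemma cvg_row_proj k : row_proj k (f x) @[x --> F] --> row_proj k A.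
Proof.
have B : gram k (f x *m (f x)^T) @[x --> F] --> gram k (A *m A^T).
  by apply: cvg_gram; apply: cvg_mulmx => //; exact: cvg_trmx.
apply: cvg_mulmx => //; apply: cvg_mulmx; last exact: cvg_cst.
apply: cvg_mulmx; first by apply: cvg_mulmx; [exact: cvg_trmx|exact: cvg_cst].
apply: cvg_invmx B; first exact: gram_unit.
by apply: filterS fu => x; exact: gram_unit.
Qed.

Lemma cvg_axis_proj k : axis_proj k (f x) @[x --> F] --> axis_proj k A.
Proof. by apply: cvgB; exact: cvg_row_proj. Qed.

Lemma cvg_frame_mx w : frame_mx w (f x) @[x --> F] --> frame_mx w A.
Proof.
rewrite /frame_mx; apply: cvg_big => [|i _]; first exact: add_continuous.
by apply: cvgZl_tmp; exact: cvg_axis_proj.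
Qed.

Lemma cvg_half_ln_minor k :
  half_ln_minor k (f x) @[x --> F] --> half_ln_minor k A.
Proof.
apply: cvgM; first exact: cvg_cst.
have Gp := spd_det_gt0 (gram_spd k Au).
have H : \det (gram k (f x *m (f x)^T)) @[x --> F] --> \det (gram k (A *m A^T)).
  by apply: cvg_det; apply: cvg_gram; apply: cvg_mulmx => //; exact: cvg_trmx.
exact: (cvg_comp _ _ H (continuous_ln Gp)).
Qed.

Lemma cvg_potential mu kappa w :
  potential mu kappa w (f x) @[x --> F] --> potential mu kappa w A.
Proof.
apply: cvg_bigsum => i; apply: cvgM; first exact: cvg_cst.
by apply: cvgB; exact: cvg_half_ln_minor.
Qed.

End Unit.

Lemma cvg_strain_form mu kappa f h A B : f @ F --> A -> h @ F --> B ->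
  strain_form mu kappa (f x) (h x) @[x --> F] --> strain_form mu kappa A B.
Proof.
move=> fA hB; apply: cvgD; (apply: cvgM; first exact: cvg_cst).
  by apply: cvg_frob; exact: cvg_dev.
by apply: cvgM; exact: cvg_mxtrace.
Qed.

End Limits.

(** * Length of a piece of class C1 *)

Section Length.
Context {R : realType} {n : nat}.
Variables (mu mu_c kappa : R) (g : 'M[R]_n -> 'M[R]_n -> 'M[R]_n -> R).
Hypotheses (hn : (0 < n)%N) (mu0 : 0 < mu) (mu_c0 : 0 < mu_c) (kappa0 : 0 < kappa).
Hypothesis hg : metric_with_moduli g mu mu_c kappa.
Implicit Types (c v : R -> 'M[R]_n) (w : 'rV[R]_n) (a b t : R).
Let leb := @lebesgue_measure R.

(** The norm of every symmetric matrix with spectrum w. *)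
Definition strain_norm w : R :=
  Num.sqrt (strain_form mu kappa (diag_mx w) (diag_mx w)).

(** The gradient of the potential has the constant norm [strain_norm w], so the
    potential is Lipschitz with that constant along every curve. *)
Lemma potential_speed_le w (c X : 'M[R]_n) : c \in unitmx ->
  strain_form mu kappa (frame_mx w c) (symm X) <=
  strain_norm w * Num.sqrt (inner mu mu_c kappa X X).
Proof.
move=> cu; apply: le_trans (strain_form_CauchySchwarz _ _ hn (ltW mu0) (ltW kappa0)) _.
rewrite strain_form_frame_mx//; apply: ler_wpM2l; first exact: sqrtr_ge0.
rewrite ler_sqrt; first exact: inner_ge_strain_form (ltW mu_c0).
apply: le_trans (inner_ge_strain_form _ _ _ (ltW mu_c0)).
by apply: strain_form_ge0; exact: ltW.
Qed.

Lemma near_within_unit a b c t : (forall s, a <= s <= b -> c s \in unitmx) ->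
  \forall s \near within [set` `[a, b]] (nbhs t), c s \in unitmx.
Proof.
move=> cu; rewrite near_withinE; apply: nearW => s /=.
by rewrite in_itv; exact: cu.
Qed.

(** The speed of c when its derivative is v. Unlike [speed], it is continuous up
    to the end points of a piece of class C1. *)
Definition invariant_speed c v t : R :=
  Num.sqrt (inner mu mu_c kappa (invmx (c t) *m v t) (invmx (c t) *m v t)).

Lemma speedE c v t : c t \in unitmx -> is_derive t 1 c (v t) ->
  speed g c t = invariant_speed c v t.
Proof. by move=> cu [_ dc]; rewrite /speed derive1E dc hg. Qed.

Lemma invariant_speed_continuous a b c v :
  (forall t, a <= t <= b -> c t \in unitmx) ->
  {within `[a, b], continuous c} -> {within `[a, b], continuous v} ->
  {within `[a, b], continuous (invariant_speed c v)}.
Proof.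
move=> cu cc cv.
move/subspace_continuousP : cc => cc; move/subspace_continuousP : cv => cv.
apply/subspace_continuousP => t tab.
apply: (continuous_cvg _ (@sqrt_continuous _ _)).
apply: cvg_inner; apply: cvg_mulmx; last exact: cv.
apply: cvg_invmx; last exact: cc.
  by apply: cu; move: tab; rewrite /= in_itv.
exact: near_within_unit.
Qed.

Lemma invmx_mul_cancel (M A X : 'M[R]_n) : M \in unitmx -> A \in unitmx ->
  invmx (M *m A) *m (M *m X) = invmx A *m X.
Proof.
move=> Mu Au; have MAu : M *m A \in unitmx by rewrite unitmx_mul Mu.
by apply: (can_inj (mulKmx MAu)); rewrite mulKVmx// -mulmxA mulKVmx.
Qed.

(** Integration of [potential_speed_le] over a piece of class C1. The left factor
    M moves the starting point of the curve to a diagonal matrix up to an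
    orthogonal factor; the speed is that of c itself, by left invariance. *)
Lemma C1_potential_le w (M : 'M[R]_n) a b c : M \in unitmx -> a < b -> C1_on a b c ->
  (forall t, a <= t <= b -> c t \in unitmx) ->
  measurable_fun `[a, b] (speed g c) /\
  ((potential mu kappa w (M *m c b) - potential mu kappa w (M *m c a))%:E <=
   (strain_norm w)%:E * \int[leb]_(s in `[a, b]) (speed g c s)%:E)%E.
Proof.
move=> Mu ab [cc [v [cv dc]]] cu; pose chi := invariant_speed c v.
have chic : {within `[a, b], continuous chi} by exact: invariant_speed_continuous.
have chiE : {in `]a, b[, speed g c =1 chi}.
  move=> t; rewrite in_itv/= => tab; apply: speedE; last exact: dc.
  by apply: cu; case/andP : tab => *; rewrite !ltW.
have mchi : measurable_fun `[a, b] chi.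
  exact: subspace_continuous_measurable_fun.
have mchi' : measurable_fun `]a, b[ chi.
  by apply: measurable_funS mchi => //; exact: subset_itv_oo_cc.
have mspeed' : measurable_fun `]a, b[ (speed g c).
  apply: eq_measurable_fun mchi' => t; rewrite inE => tab.
  by rewrite chiE.
have mspeed : measurable_fun `[a, b] (speed g c).
  by apply/measurable_fun_itv_bndo_bndcP/measurable_fun_itv_obnd_cbndP.
split; first exact: mspeed.
rewrite (eq_integral_itv_bounded _ _ mspeed' mchi' chiE).
pose D t := strain_form mu kappa (frame_mx w (M *m c t)) (symm (invmx (c t) *m v t)).
have Mcu t : c t \in unitmx -> M *m c t \in unitmx by rewrite unitmx_mul Mu.
have c_at t : `[a, b]%classic t ->
    [/\ c t \in unitmx, c @ within `[a, b]%classic (nbhs t) --> c t,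
        M *m c x @[x --> within `[a, b]%classic (nbhs t)] --> M *m c t,
        v @ within `[a, b]%classic (nbhs t) --> v t &
        \forall s \near within `[a, b]%classic (nbhs t), c s \in unitmx].
  move/subspace_continuousP : (cc) => cc'; move/subspace_continuousP : (cv) => cv'.
  move=> tab; split; [|exact: cc'| |exact: cv'|exact: near_within_unit].
    by apply: cu; move: tab; rewrite /= in_itv.
  by apply: cvg_mulmx; [exact: cvg_cst|exact: cc'].
have c_near t : (\forall s \near within `[a, b]%classic (nbhs t), c s \in unitmx) ->
    \forall s \near within `[a, b]%classic (nbhs t), M *m c s \in unitmx.
  by apply: filterS => s; exact: Mcu.
have Pc : {within `[a, b], continuous (fun t => potential mu kappa w (M *m c t))}.
  apply/subspace_continuousP => t /c_at[cut _ Mct _ cn].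
  apply: (cvg_potential (f := fun s => M *m c s)) => //; exact: Mcu.
have Dc : {within `[a, b], continuous D}.
  apply/subspace_continuousP => t /c_at[cut ct Mct vt cn]; apply: cvg_strain_form.
    apply: (cvg_frame_mx (f := fun s => M *m c s)) => //; [exact: Mcu|exact: c_near].
  by apply: cvg_symm; apply: cvg_mulmx => //; exact: cvg_invmx.
have dP t : t \in `]a, b[ ->
    is_derive t 1 (fun t => potential mu kappa w (M *m c t)) (D t).
  rewrite in_itv /= => tab.
  have cut : c t \in unitmx by apply: cu; case/andP : tab => *; rewrite !ltW.
  rewrite /D -(invmx_mul_cancel _ Mu cut).
  have dMc : is_derive t 1 (fun s => M *m c s) (M *m v t).
    have := is_derive_mulmx (is_derive_cst M t 1) (dc t tab).
    by rewrite mul0mx add0r.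
  exact: (@is_derive_potential R n mu kappa hn w _ _ t (Mcu _ cut) dMc).
pose P t := potential mu kappa w (M *m c t).
have -> : (P b - P a)%:E = (\int[leb]_(t in `[a, b]) (D t)%:E)%E.
  apply/esym/continuous_FTC2 => //.
    have [_ Pa Pb] := (continuous_within_itvP _ ab).1 Pc.
    by split; [move=> t tab; have [dPt _] := dP t tab; exact: dPt|exact: Pa|exact: Pb].
  by move=> t tab; rewrite derive1E; have [_ ->] := dP t tab.
have int h : {within `[a, b], continuous h} -> leb.-integrable `[a, b] (EFin \o h).
  by move=> hc; apply: continuous_compact_integrable => //; exact: segment_compact.
rewrite -integralZl//; last exact: int.
apply: le_integral => //; first exact: int.
  rewrite (_ : (fun _ => _) = EFin \o (fun t => strain_norm w * chi t))//.
  apply: int => t; apply: cvgM; [exact: cvg_cst|exact: chic].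
move=> t; rewrite inE => /c_at[cu' _ _ _ _].
by rewrite -EFinM lee_fin; apply: potential_speed_le; exact: Mcu.
Qed.
End Length.

(** * Length of a piecewise C1 curve *)

Section Chain.
Context {R : realType} {n : nat}.
Variables (mu mu_c kappa : R) (g : 'M[R]_n -> 'M[R]_n -> 'M[R]_n -> R).
Hypotheses (hn : (0 < n)%N) (mu0 : 0 < mu) (mu_c0 : 0 < mu_c) (kappa0 : 0 < kappa).
Hypothesis hg : metric_with_moduli g mu mu_c kappa.
Implicit Types (c v : R -> 'M[R]_n) (w : 'rV[R]_n) (a b t : R).
Let leb := @lebesgue_measure R.

Lemma path_le_last (x : R) s : path <%R x s -> x <= last x s.
Proof.
elim: s x => //= y s IH x /andP[xy ys].
by rewrite (le_trans (ltW xy))// IH.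
Qed.

(** Induction on the breakpoints. Measurability of the speed is part of the
    statement because additivity of the integral on adjacent intervals needs it. *)
Lemma piecewise_potential_le w (M : 'M[R]_n) x s c : M \in unitmx -> path <%R x s ->
  (forall i, (i < size s)%N -> C1_on (nth 0 (x :: s) i) (nth 0 (x :: s) i.+1) c) ->
  (forall t, x <= t <= last x s -> c t \in unitmx) ->
  measurable_fun `[x, last x s] (speed g c) /\
  ((potential mu kappa w (M *m c (last x s)) - potential mu kappa w (M *m c x))%:E <=
   (strain_norm mu kappa w)%:E * \int[leb]_(t in `[x, last x s]) (speed g c t)%:E)%E.
Proof.
move=> Mu; elim: s x => [|y s IH] x.
  move=> _ _ _ /=; rewrite set_itv1; split; first exact: measurable_fun_set1.
  by rewrite integral_set1 mule0 subrr.
move=> /= /andP[xy ys] cC1 cu.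
have yl := path_le_last ys.
have [|m1 le1] := C1_potential_le hn mu0 mu_c0 kappa0 hg w Mu xy (cC1 0%N isT).
  by move=> t /andP[xt ty]; apply: cu; rewrite xt (le_trans ty).
have [||m2 le2] := IH y ys.
- by move=> i si; exact: (cC1 i.+1 si).
- by move=> t /andP[yt tl]; apply: cu; rewrite tl (le_trans (ltW xy)).
(* The second interval is open at y, which makes the union disjoint. *)
have itvE : [set` `[x, last y s]] = [set` `[x, y]] `|` [set` `]y, last y s]].
  by rewrite -itv_bndbnd_setU// bnd_simp// ltW.
have m2' : measurable_fun `]y, last y s] (speed g c).
  by apply/measurable_fun_itv_obnd_cbndP.
have m12 : measurable_fun `[x, last y s] (speed g c).
  by rewrite itvE; apply/measurable_funU.
split; first exact: m12.
rewrite itvE ge0_integral_setU//=; last 3 first.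
- by rewrite -itvE; exact/measurable_EFinP.
- by move=> t _; rewrite lee_fin sqrtr_ge0.
- rewrite disj_set2E; apply/eqP/seteqP; split=> // t [] /=; rewrite !in_itv /=.
  by move=> /andP[_ ty] /andP[]; rewrite ltNge ty.
rewrite (integral_itv_obnd_cbnd (f := fun t => (speed g c t)%:E)); last first.
  exact/measurable_EFinP.
rewrite ge0_muleDr; last 2 first.
- by apply: integral_ge0 => t _; rewrite lee_fin sqrtr_ge0.
- by apply: integral_ge0 => t _; rewrite lee_fin sqrtr_ge0.
apply: le_trans (leeD le1 le2).
by rewrite -EFinD lee_fin [leRHS]addrC subrKA.
Qed.

End Chain.

(** * Distance to an orthogonal matrix *)

Section Distance.
Context {R : realType} {n : nat}.
Variables (mu mu_c kappa : R) (g : 'M[R]_n -> 'M[R]_n -> 'M[R]_n -> R).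
Hypotheses (hn : (0 < n)%N) (mu0 : 0 < mu) (mu_c0 : 0 < mu_c) (kappa0 : 0 < kappa).
Hypothesis hg : metric_with_moduli g mu mu_c kappa.
Implicit Types (A B X Y F P Q M L U : 'M[R]_n) (l : 'rV[R]_n).

Lemma frob_conj Q A B : Q *m Q^T = 1%:M ->
  frob (Q^T *m A *m Q) (Q^T *m B *m Q) = frob A B :> R.
Proof.
move=> QQ; rewrite /frob !trmx_mul trmxK -!mulmxA (mulmxA Q) QQ mul1mx.
by rewrite mxtrace_mulC -!mulmxA QQ mulmx1.
Qed.

Lemma mxtrace_conj Q A : Q *m Q^T = 1%:M -> \tr (Q^T *m A *m Q) = \tr A :> R.
Proof. by move=> QQ; rewrite -mulmxA mxtrace_mulC -mulmxA QQ mulmx1. Qed.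

Lemma strain_form_spectral Q l : Q *m Q^T = 1%:M ->
  strain_form mu kappa (Q^T *m diag_mx l *m Q) (Q^T *m diag_mx l *m Q) =
  strain_form mu kappa (diag_mx l) (diag_mx l).
Proof. by move=> QQ; rewrite !strain_formE// frob_conj// mxtrace_conj. Qed.

Lemma strain_formN X Y : strain_form mu kappa (- X) Y = - strain_form mu kappa X Y.
Proof.
by rewrite !strain_formE// (frobC _ Y) (frobC X) -[- X]scaleN1r frobZr mxtraceZ; ring.
Qed.

Lemma strain_formNN X : strain_form mu kappa (- X) (- X) = strain_form mu kappa X X.
Proof.
by rewrite !strain_formE// -[- X]scaleN1r frobZr frobC frobZr mxtraceZ; ring.
Qed.

(** With weights - l, the potential grows from - |l|^2 at M F to 0 at M P, where
    |l| is [strain_norm l]. *)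
Lemma curve_length_ge M l F P c : M \in unitmx ->
  (M *m F) *m (M *m F)^T = diag_mx (map_mx (fun x => expR (2 * x)) l) ->
  (M *m P) *m (M *m P)^T = 1%:M ->
  admissible F P c ->
  ((strain_norm mu kappa l)%:E <= curve_length g c)%E.
Proof.
move=> Mu MF MP [_ [s [ps ls C1s]] cG c0 c1].
have cu t : 0 <= t <= 1 -> c t \in unitmx.
  by move=> /cG ct; rewrite unitmxE unitfE gt_eqF.
have := @piecewise_potential_le R n mu mu_c kappa g hn mu0 mu_c0 kappa0 hg
  (- l) M 0 s c Mu ps C1s.
rewrite ls => /(_ cu)[_].
(* At the end point c c^T = 1, which is the diagonal case with exponents 0. *)
rewrite c0 c1 (potential_diag _ _ hn _ MF) (@potential_diag _ _ _ _ hn _ _ 0); last first.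
  rewrite MP -diag_const_mx; congr diag_mx; apply/rowP => i.
  by rewrite !mxE mulr0 expR0.
have s0 : strain_form mu kappa (diag_mx (- l)) (diag_mx 0) = 0.
  by rewrite strain_formE// (raddf0 (@diag_mx R n)) /frob mulmx0 linear0 !mulr0 addr0.
have DN : diag_mx (- l) = - diag_mx l by exact: raddfN.
rewrite s0 DN strain_formN opprK add0r /strain_norm DN strain_formNN.
set N2 := strain_form _ _ _ _; rewrite -/(curve_length g c) => H.
have N20 : 0 <= N2 by apply: strain_form_ge0; exact: ltW.
(* H is N2 <= sqrt N2 * length; the division requires N2 != 0. *)
have [->|N2p] := eqVneq N2 0.
  by rewrite sqrtr0; apply: integral_ge0 => t _; rewrite lee_fin sqrtr_ge0.
have Np : 0 < Num.sqrt N2 by rewrite sqrtr_gt0 lt_neqAle eq_sym N2p.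
by rewrite -(@lee_pmul2l _ (Num.sqrt N2)%:E)// -EFinM -expr2 sqr_sqrtr.
Qed.

Section ExpCurve.
Variables (F Q : 'M[R]_n) (l : 'rV[R]_n).
Hypotheses (QQ : Q *m Q^T = 1%:M) (hF : GLp R n F).

Let L := Q^T *m diag_mx l *m Q.
(** The curve F exp(- t L) for the symmetric matrix L = Q^T diag(l) Q. *)
Definition exp_curve (t : R) : 'M[R]_n :=
  F *m (Q^T *m diag_mx (\row_i expR (- t * l 0 i)) *m Q).

Lemma exp_curve_derive (t : R) : is_derive t (1 : R) exp_curve (exp_curve t *m - L).
Proof.
pose E s : 'M[R]_n := diag_mx (\row_i expR (- s * l 0 i)).
have dE : is_derive t 1 E (E t *m - diag_mx l).
  apply/is_derive_mxP => i j; rewrite mulmxN mulmx_diag !mxE.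
  have d : is_derive t 1 (fun s => expR (- s * l 0 i))
      (- (expR (- t * l 0 i) * l 0 i)).
    have H1 : is_derive t 1 (fun s : R => - s * l 0 i) (- l 0 i).
      have := is_deriveZ (- l 0 i) (is_derive_id t (1 : R)).
      rewrite /GRing.scale /= mulr1 (_ : _ \*: id = (fun s : R => - s * l 0 i)) //.
      by apply/funext => s; rewrite /= /GRing.scale /= mulNr mulrC mulNr.
    have := @is_derive1_comp R expR (fun s => - s * l 0 i) t _ _ (is_derive_expR _) H1.
    by rewrite mulrN.
  have := is_deriveZ ((i == j)%:R) d; rewrite /GRing.scale /= => d'.
  rewrite (_ : (fun s => E s i j) = (i == j)%:R \*: (fun s => expR (- s * l 0 i))).
    apply: is_derive_eq d' _.
    by have [->|_] := eqVneq i j; rewrite ?mul1r ?mul0r ?mulr1n ?mulr0n ?oppr0.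
  apply/funext => s; rewrite /E !mxE /= /GRing.scale /=.
  by case: (i == j); rewrite ?mul1r ?mul0r ?mulr1n ?mulr0n.
have d1 := is_derive_mulmx (is_derive_cst (Q^T) t 1) dE.
have d2 := is_derive_mulmx d1 (is_derive_cst Q t 1).
have d3 := is_derive_mulmx (is_derive_cst F t 1) d2.
apply: is_derive_eq d3 _.
rewrite !mul0mx !mulmx0 add0r addr0 add0r /exp_curve /L -/(E t) /=.
rewrite !mulmxN !mulNmx !mulmxN !mulmxA.
by rewrite -(mulmxA _ Q Q^T) QQ mulmx1.
Qed.

Lemma exp_curve_GLp t : GLp R n (exp_curve t).
Proof.
rewrite /GLp /= /exp_curve det_mulmx mulr_gt0//; apply: spd_det_gt0.
by apply: spd_spectral => // i; rewrite mxE expR_gt0.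
Qed.

Lemma exp_curve0 : exp_curve 0 = F.
Proof.
rewrite /exp_curve (_ : \row_i _ = const_mx 1).
  by rewrite diag_const_mx mulmx1 (mulmx1C QQ) mulmx1.
by apply/rowP => i; rewrite !mxE oppr0 mul0r expR0.
Qed.

Lemma exp_curve1 : exp_curve 1 = F *m invmx (Q^T *m diag_mx (map_mx expR l) *m Q).
Proof.
rewrite /exp_curve; congr (_ *m _).
set A := (X in invmx X); have Au : A \in unitmx.
  by apply/spd_unit/spd_spectral => // i; rewrite mxE expR_gt0.
apply: (can_inj (mulKmx Au)); rewrite mulmxV// /A.
rewrite !mulmxA -(mulmxA _ Q) QQ mulmx1 -(mulmxA Q^T) mulmx_diag.
rewrite (_ : \row_i _ = const_mx 1) ?diag_const_mx ?mulmx1 ?(mulmx1C QQ)//.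
by apply/rowP => i; rewrite !mxE -expRD mulN1r subrr expR0.
Qed.

(** The velocity c^-1 c' is - L at all times, and L is symmetric, so that the
    speed is constant and free of the spin term. *)
Lemma exp_curve_length :
  curve_length g exp_curve = (strain_norm mu kappa l)%:E.
Proof.
rewrite /curve_length (_ : (fun _ => _) = cst (strain_norm mu kappa l)%:E).
  rewrite integral_cst//= lebesgue_measure_itv/= lte_fin ltr01 -EFinD subr0.
  by rewrite mule1.
apply/funext => t; rewrite /speed /cst derive1E.
have [_ ->] := exp_curve_derive t.
have cu : exp_curve t \in unitmx.
  by rewrite unitmxE unitfE gt_eqF//; exact: exp_curve_GLp.
rewrite hg// mulKmx// inner_symmetric; last first.
  by rewrite linearN /= /L !trmx_mul trmxK tr_diag_mx mulmxA.
by rewrite strain_formNN strain_form_spectral.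
Qed.

Lemma exp_curve_admissible : admissible F (exp_curve 1) exp_curve.
Proof.
have cc t : {for t, continuous exp_curve}.
  by apply/differentiable_continuous/derivable1_diffP; case: (exp_curve_derive t).
have cw (S : set R) : {within S, continuous exp_curve}.
  exact: continuous_subspaceT.
split=> //; last by rewrite exp_curve0.
- exists [:: 1]; split=> //=; first by rewrite ltr01.
  case=> // _ /=; split; first exact: cw.
  exists (fun t => exp_curve t *m - L); split; last by move=> t _; exact: exp_curve_derive.
  apply: continuous_subspaceT => t; apply: cvg_mulmx; first exact: cc.
  exact: cvg_cst.
- by move=> t _; exact: exp_curve_GLp.
Qed.

End ExpCurve.
End Distance.

(** * Distance of the polar factor *)

Section PolarDistance.
Context {R : realType} {n : nat}.
Variables (mu mu_c kappa : R) (g : 'M[R]_n -> 'M[R]_n -> 'M[R]_n -> R).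
Hypotheses (hn : (0 < n)%N) (mu0 : 0 < mu) (mu_c0 : 0 < mu_c) (kappa0 : 0 < kappa).
Hypothesis hg : metric_with_moduli g mu mu_c kappa.
Variables (Rot Q : 'M[R]_n) (l : 'rV[R]_n).
Hypotheses (QQ : Q *m Q^T = 1%:M) (hRot : SO R n Rot).
Let U := Q^T *m diag_mx (map_mx expR l) *m Q.
Let F := Rot *m U.

Let U_spd : spd U.
Proof. by apply: spd_spectral => // i; rewrite mxE expR_gt0. Qed.

Let hF : GLp R n F.
Proof. by rewrite /GLp /= /F det_mulmx hRot.2 mul1r spd_det_gt0. Qed.

(** The translation by Q Rot^T takes F to diag(e^l) Q and keeps P orthogonal. *)
Lemma geod_dist_orthogonal_ge (P : 'M[R]_n) : P^T *m P = 1%:M ->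
  ((strain_norm mu kappa l)%:E <= geod_dist g F P)%E.
Proof.
move=> PP; have [RR _] := hRot.
have Ru : Rot^T \in unitmx by case/mulmx1_unit : RR.
have Qu : Q \in unitmx by case/mulmx1_unit : QQ.
apply: le_ereal_inf_tmp => _ [c hc <-].
apply: (@curve_length_ge _ _ _ _ _ _ hn mu0 mu_c0 kappa0 hg (Q *m Rot^T) l F P) => //.
- by rewrite unitmx_mul Qu.
- have -> : Q *m Rot^T *m F = diag_mx (map_mx expR l) *m Q.
    by rewrite /F -mulmxA (mulmxA Rot^T) RR mul1mx /U !mulmxA QQ mul1mx.
  rewrite trmx_mul tr_diag_mx -mulmxA (mulmxA Q) QQ mul1mx mulmx_diag.
  by congr diag_mx; apply/rowP => i; rewrite !mxE -expRD -mulr2n mulr_natl.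
- rewrite !trmx_mul trmxK !mulmxA -(mulmxA _ P) (mulmx1C PP) mulmx1.
  by rewrite -(mulmxA Q) RR mulmx1 QQ.
Qed.

(** The exponential curve reaches Rot, and its length equals the lower bound. *)
Lemma geod_dist_polar_factor : geod_dist g F Rot = (strain_norm mu kappa l)%:E.
Proof.
apply/eqP; rewrite eq_le geod_dist_orthogonal_ge ?andbT; last exact: hRot.1.
have := exp_curve_admissible l QQ hF.
rewrite exp_curve1// -/U /F mulmxK; last exact: spd_unit.
move=> adm; rewrite -(exp_curve_length hn hg l QQ hF).
by apply: ereal_inf_lbound; exists (exp_curve F Q l).
Qed.

Lemma geod_dist_sq_SO_polar :
  geod_dist_sq_SO g F = ((strain_norm mu kappa l)%:E ^+ 2)%E.
Proof.
have N0 : (0 <= (strain_norm mu kappa l)%:E)%E by rewrite lee_fin sqrtr_ge0.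
have SN : [set (geod_dist g F P ^+ 2)%E | P in SO R n]
    ((strain_norm mu kappa l)%:E ^+ 2)%E.
  by exists Rot => //; rewrite geod_dist_polar_factor.
have LN : lbound [set (geod_dist g F P ^+ 2)%E | P in SO R n]
    ((strain_norm mu kappa l)%:E ^+ 2)%E.
  move=> _ [P [PP _] <-]; rewrite !expe2.
  by apply: lee_pmul => //; exact: geod_dist_orthogonal_ge.
apply: xget_unique; first by split.
move=> m [Sm Lm]; apply/eqP; rewrite eq_le Lm//; exact: LN.
Qed.

End PolarDistance.

Theorem theorem2 (R : realType) (n : nat) (hn : (0 < n)%N)
    (mu mu_c kappa : R) (hmu : 0 < mu) (hmu_c : 0 < mu_c) (hkappa : 0 < kappa)
    (g : 'M[R]_n -> 'M[R]_n -> 'M[R]_n -> R)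
    (hg : metric_with_moduli g mu mu_c kappa)
    (F : 'M[R]_n) (hF : GLp R n F)
    (Rot U : 'M[R]_n) (hRot : Rot = polar F) (hU : U = msqrt (F^T *m F)) :
  [/\ (* the polar decomposition *)
      F = Rot *m U /\ SO R n Rot /\ spd U,
      geod_dist_sq_SO g F = (geod_dist g F Rot ^+ 2)%E,
      (geod_dist g F Rot ^+ 2)%E =
        (mu * frob_norm (dev (mlog U)) ^+ 2 + kappa / 2 * \tr (mlog U) ^+ 2)%:E &
      (* independence of the spin modulus *)
      forall (mu_c' : R) (g' : 'M[R]_n -> 'M[R]_n -> 'M[R]_n -> R),
        0 < mu_c' -> metric_with_moduli g' mu mu_c' kappa ->
        geod_dist_sq_SO g' F = geod_dist_sq_SO g F].
Proof.
have Fu : F \in unitmx by rewrite unitmxE unitfE gt_eqF.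
have FF : spd (F^T *m F).
  rewrite -[F^T *m F]addr0 -[X in _ + X](mulmx0 _ (0 : 'M[R]_n)^T).
  by apply: sumsq_spd => v Fv _; rewrite -[v](mulKmx Fu) Fv mulmx0.
have [Us UU] := msqrtP FF; rewrite -hU in Us UU.
have Uu := spd_unit Us.
have FE : F = Rot *m U by rewrite hRot /polar -hU mulmxKV.
have RR : Rot^T *m Rot = 1%:M.
  rewrite hRot /polar -hU trmx_mul trmx_inv Us.1 !mulmxA -(mulmxA _ F^T) -UU.
  by rewrite mulmxA mulVmx// mul1mx mulmxV.
have RSO : SO R n Rot.
  split=> //; have : 0 < \det Rot.
    by rewrite -(pmulr_lgt0 _ (spd_det_gt0 Us)) -det_mulmx -FE.
  have : \det Rot ^+ 2 = 1 by rewrite expr2 -{1}det_tr -det_mulmx RR det1.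
  by move=> /eqP; rewrite sqrf_eq1 => /orP[/eqP->//|/eqP->]; rewrite ltr0N1.
have [Ls LU] := mlogP Us; have [Q [l [QQ LE]]] := symmetric_spectral Ls.
have UE : U = Q^T *m diag_mx (map_mx expR l) *m Q by rewrite -LU LE mexp_spectral.
have sq mc h : 0 < mc -> metric_with_moduli h mu mc kappa ->
    geod_dist_sq_SO h F = ((strain_norm mu kappa l)%:E ^+ 2)%E.
  move=> mc0 hh; rewrite FE UE.
  exact: (geod_dist_sq_SO_polar hn hmu mc0 hkappa hh l QQ RSO).
have dist : geod_dist g F Rot = (strain_norm mu kappa l)%:E.
  by rewrite FE UE; exact: (geod_dist_polar_factor hn hmu hmu_c hkappa hg l QQ RSO).
split; [by []|by rewrite dist; exact: sq hmu_c hg| |].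
  rewrite dist -EFin_expe; congr EFin.
  rewrite /strain_norm sqr_sqrtr; last by apply: strain_form_ge0; exact: ltW.
  rewrite -(strain_form_spectral _ _ hn _ QQ) -LE /strain_form.
  by rewrite /frob_norm sqr_sqrtr ?frob_ge0// -[\tr _ ^+ 2]expr2.
by move=> mc h mc0 hh; rewrite (sq _ _ hmu_c hg) (sq _ _ mc0 hh).
Qed.
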